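(* Let $f=(f_1,\dots,f_n):\mathbb{C}^n\to\mathbb{C}^n$ be a polynomial map. (1) If each $f_j$ is dominated by a monomial term, then $f$ is algebraically stable on $(\mathbb{P}^1)^n$. (2) Assume that, for some iterate $f^N=(f^{(N)}_1,\dots,f^{(N)}_n)$ of $f$ (with $N$ a positive integer), we have $\deg_{z_i}(f^{(N)}_j)>0$ for all $i,j=1,\dots,n$. Then $f$ being algebraically stable on $(\mathbb{P}^1)^n$ implies that each $f_j$ must have a dominant term.
   Context: For $h\in\mathbb{C}[z_1,\dots,z_n]$, a monomial $\mu=z_1^{a_1}\cdots z_n^{a_n}$ is a monomial term of $h$ if its coefficient in $h$ is nonzero. A monomial term $\mu$ of $h$ is the dominant term of $h$ (and $h$ is then said to be dominated by $\mu$) if $\deg_{z_i}(h)=\deg_{z_i}(\mu)$ for all $i=1,\dots,n$, where $\deg_{z_i}$ is the degree in the variable $z_i$. A polynomial map $f$ induces a rational self map of $(\mathbb{P}^1)^n$ through $z_i=x_i/y_i$, where $([x_1;y_1],\dots,[x_n;y_n])$ are the coordinates on $(\mathbb{P}^1)^n$. One has $\mathrm{Pic}((\mathbb{P}^1)^n)=\bigoplus_{i=1}^n\mathbb{Z}[D_i]$ with $D_i=\{x_i=0\}$, and the pull back $f^*$ on $\mathrm{Pic}((\mathbb{P}^1)^n)$ is represented, with respect to the ordered basis $[D_1],\dots,[D_n]$, by the degree matrix $\mathrm{Deg}(f)=\bigl(\max\{\deg_{z_i}(f_j),0\}\bigr)_{1\le i\le n;\,1\le j\le n}$ (with $i$ the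 row and $j$ the column index). The map $f$ is algebraically stable on $(\mathbb{P}^1)^n$ if $(f^k)^*=(f^* )^k$ on $\mathrm{Pic}((\mathbb{P}^1)^n)$ for all positive integers $k$, i.e. if $\mathrm{Deg}(f^k)=\mathrm{Deg}(f)^k$ for all positive integers $k$.
   Formalization: Part (1) is proved assuming that no component f_j is a constant polynomial (true for every dominant f); without this it fails: f=(z1z2−z1, 1) has dominated components, but f^2=(0,1), so Deg(f^2)=0 while Deg(f)^2=Deg(f)≠0. *)

(* Defs.v *)
From HB Require Import structures.
From mathcomp Require Import all_boot all_order all_algebra.
From mathcomp Require Import reals.
From mathcomp Require Import complex mpoly.

Set Implicit Arguments.
Unset Strict Implicit.
Unset Printing Implicit Defensive.

Import GRing.Theory.
Local Open Scope ring_scope.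

(* A polynomial map C^n -> C^n is the tuple of its coordinate polynomials over
   C = R[i], with R : realType. *)
Notation polymap R n := (n.-tuple {mpoly R[i][n]}).

(* The degree of h in the variable z_i. For h = 0 the empty maximum is 0, so
   this is max{deg_{z_i}(h), 0}; the two conventions differ only at h = 0. *)
Definition degz (R : realType) (n : nat) (i : 'I_n) (h : {mpoly R[i][n]}) : nat :=
  (\max_(m <- msupp h) m i)%N.

(* 'X_[m] is the dominant term of h; membership in msupp forces h != 0. *)
Definition dominated_by (R : realType) (n : nat) (h : {mpoly R[i][n]})
    (m : 'X_{1..n}) : Prop :=
  m \in msupp h /\ forall i : 'I_n, degz i h = degz i ('X_[m] : {mpoly R[i][n]}).

Definition has_dominant_term (R : realType) (n : nat) (h : {mpoly R[i][n]}) : Prop :=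
  exists m : 'X_{1..n}, dominated_by h m.

Definition comp_map (R : realType) (n : nat) (f g : polymap R n) : polymap R n :=
  [tuple tnth f j \mPo g | j < n].

Definition iter_map (R : realType) (n : nat) (f : polymap R n) (k : nat) : polymap R n :=
  iter k (comp_map f) [tuple 'X_i | i < n].

Lemma iter_map_meval (R : realType) (n : nat) (f : polymap R n) (k : nat)
    (v : 'I_n -> R[i]) (j : 'I_n) :
  (tnth (iter_map f k) j).@[v] =
  iter k (fun w l => (tnth f l).@[w]) v j.
Proof.
elim: k j => [|k IHk] j /=; first by rewrite tnth_mktuple mevalXU.
by rewrite tnth_mktuple comp_mpoly_meval; apply: meval_eq => l; rewrite IHk.
Qed.

(* The matrix of f^* on Pic((P^1)^n) = Z^n in the basis [D_1], ..., [D_n]. *)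
Definition Deg (R : realType) (n : nat) (f : polymap R n) : 'M[int]_n :=
  \matrix_(i < n, j < n) (degz i (tnth f j))%:Z.

Definition algebraically_stable (R : realType) (n : nat) (f : polymap R n) : Prop :=
  forall k : nat, (0 < k)%N -> Deg (iter_map f k) = Deg f ^+ k.

(* Every dominant map satisfies this. Without it, having dominant terms does not
   imply algebraic stability: for f = (z_1 z_2 - z_1, 1) both components have a
   dominant term, but f^2 = (0, 1), whereas Deg(f)^2 = Deg(f) <> 0 = Deg(f^2). *)
Definition nonconstant_components (R : realType) (n : nat) (f : polymap R n) : Prop :=
  forall (j : 'I_n) (c : R[i]), tnth f j <> c%:MP.

(* Main.v *)
Require Import Defs.
From mathcomp Require Import all_boot all_order all_algebra.
From mathcomp Require Import reals.
From mathcomp Require Import complex mpoly.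

(** Everything rests on one inequality for a composition of polynomial maps.
    If [g] is substituted in a polynomial [p], each monomial [m] of [p] becomes
    the product of the [g_l ^+ m_l], whose degree in [z_i] is the weighted sum
    of the [m_l] with weights the degrees [d_l] of the [g_l] in [z_i]. Hence
    the degree of [p \mPo g] is at most the largest of these weighted sums
    ([degz_comp_le]), itself at most the sum of the [degz l p * d_l], which is
    the entry of the product of the degree matrices. Algebraic stability says
    that no degree is lost between the two ends.

    If [p] has a dominant term [mu] and each [g_l] a dominant term [nu_l] other
    than the monomial 1, nothing is lost: the product of the [nu_l ^+ mu_l]
    comes from [mu] alone, because lowering one exponent of [mu] lowers the
    bound on some degree, so it cannot cancel and is again a dominant term
    ([dominated_comp]). By induction every iterate has dominated components and
    the degree matrix is multiplicative along the iteration.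

    Conversely, if all the weights [d_l] are positive and nothing is lost, then
    some monomial of [p] has the weighted sum that the partial degrees of [p]
    give. As it is bounded by them exponent by exponent, it must equal them all:
    it is the dominant term ([dominated_of_degz_comp]). The assumption on
    [f^N] gives such weights with [g = f^N], and stability at the two orders
    [N] and [N + 1] gives the equality. *)

Set Implicit Arguments.
Unset Strict Implicit.
Unset Printing Implicit Defensive.

Import Order.TTheory GRing.Theory.
Local Open Scope ring_scope.

(** * Partial degrees *)

Lemma degz_leP (R : realType) n (i : 'I_n) (h : {mpoly R[i][n]}) d :
  reflect (forall m, m \in msupp h -> (m i <= d)%N) (degz i h <= d)%N.
Proof.
apply: (iffP (bigmax_leqP_seq _ _ _ _)) => H m mh; first exact: H.
by move=> _; apply: H.
Qed.

Lemma degz_geq (R : realType) n (i : 'I_n) (h : {mpoly R[i][n]}) m :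
  m \in msupp h -> (m i <= degz i h)%N.
Proof. by move=> mh; apply: (degz_leP i h (degz i h) _). Qed.

Lemma degz0 (R : realType) n (i : 'I_n) : degz i (0 : {mpoly R[i][n]}) = 0%N.
Proof. by rewrite /degz msupp0 big_nil. Qed.

Lemma degzXm (R : realType) n (i : 'I_n) m :
  degz i ('X_[m] : {mpoly R[i][n]}) = m i.
Proof. by rewrite /degz msuppX big_seq1. Qed.

Lemma degz1 (R : realType) n (i : 'I_n) : degz i (1 : {mpoly R[i][n]}) = 0%N.
Proof. by rewrite /degz msupp1 big_seq1 mnm0E. Qed.

Lemma degzM_le (R : realType) n (i : 'I_n) (p q : {mpoly R[i][n]}) :
  (degz i (p * q) <= degz i p + degz i q)%N.
Proof.
apply/degz_leP => m /msuppM_le /allpairsP [[m1 m2] /= [h1 h2 ->]].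
by rewrite mnmDE leq_add // degz_geq.
Qed.

Lemma degzX_le (R : realType) n (i : 'I_n) (p : {mpoly R[i][n]}) k :
  (degz i (p ^+ k) <= k * degz i p)%N.
Proof.
elim: k => [|k IH]; first by rewrite expr0 degz1.
rewrite exprS mulSn; apply: leq_trans (degzM_le _ _ _) _.
by rewrite leq_add2l.
Qed.

Lemma degz_prodX_le (R : realType) n k (g : k.-tuple {mpoly R[i][n]})
    (m : 'X_{1..k}) (i : 'I_n) :
  (degz i (\prod_(l < k) tnth g l ^+ m l)
     <= \sum_(l < k) m l * degz i (tnth g l))%N.
Proof.
elim/big_rec2: _ => [|l d p _ IH]; first by rewrite degz1.
by apply: leq_trans (degzM_le _ _ _) (leq_add (degzX_le _ _ _) IH).
Qed.

Lemma degz_comp_le (R : realType) n k (p : {mpoly R[i][k]})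
    (g : k.-tuple {mpoly R[i][n]}) (i : 'I_n) :
  (degz i (p \mPo g)
     <= \max_(m <- msupp p) \sum_(l < k) m l * degz i (tnth g l))%N.
Proof.
apply/degz_leP => m; rewrite comp_mpolyE.
move=> /msupp_sum_le /flattenP [s /mapP [m' ]].
rewrite mem_filter /= => m'p -> /msuppZ_le /degz_geq -/(_ i) mi.
apply: leq_trans mi (leq_trans (degz_prodX_le _ _ _) _).
by apply: (bigmaxn_sup_seq _ m'p).
Qed.

(** * Dominant terms *)

Lemma dominated_byE (R : realType) n (h : {mpoly R[i][n]}) m :
  dominated_by h m <-> m \in msupp h /\ forall i, degz i h = m i.
Proof. by split=> -[mh H]; split=> // i; rewrite H degzXm. Qed.

Lemma dominated_byXm (R : realType) n m :
  dominated_by ('X_[m] : {mpoly R[i][n]}) m.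
Proof. by split=> //; rewrite msuppX mem_seq1. Qed.

Lemma dominated_neq0 (R : realType) n (h : {mpoly R[i][n]}) m :
  dominated_by h m -> h != 0.
Proof. by case=> mh _; apply: contraTneq mh => ->; rewrite msupp0. Qed.

(** The monomial order refines divisibility, so a dominant term is the leading
    one; this reduces products of dominated polynomials to the multiplicativity
    of leading monomials. *)
Lemma dominated_mlead (R : realType) n (h : {mpoly R[i][n]}) m :
  dominated_by h m -> mlead h = m.
Proof.
move=> hm; have h0 := dominated_neq0 hm.
move/dominated_byE: hm => [mh H]; apply: le_anti.
rewrite msupp_le_mlead // andbT; apply/lem_leo/mnm_lepP => i.
by rewrite -H degz_geq // mlead_supp.
Qed.

Lemma dominated0_const (R : realType) n (h : {mpoly R[i][n]}) :
  dominated_by h 0%MM -> h = (h@_0%MM)%:MP.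
Proof.
move=> /dominated_byE [_ H]; apply/mpolyP => m; rewrite mcoeffC.
case: eqVneq => [<-|m0]; first by rewrite mulr1.
rewrite mulr0; apply: memN_msupp_eq0; apply: contra_neqN m0 => mh.
apply/mnmP => i; apply/eqP; rewrite mnm0E -leqn0.
by rewrite (leq_trans (degz_geq i mh)) // H mnm0E.
Qed.

Lemma mnm_neq0_gt0 n (m : 'X_{1..n}) : m != 0%MM -> exists i, (0 < m i)%N.
Proof.
move=> m0; apply/existsP; apply: contra_neqT m0; rewrite negb_exists.
by move=> /forallP H; apply/mnmP => i; apply/eqP; rewrite mnm0E -leqn0 leqNgt.
Qed.

Lemma mnm_sum_mulE n k (nu : 'I_k -> 'X_{1..n}) (mu : 'X_{1..k}) i :
  ((\sum_(l < k) nu l *+ mu l)%MM i = \sum_(l < k) mu l * nu l i)%N.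
Proof. by rewrite mnm_sumE; apply: eq_bigr => l _; rewrite mulmnE mulnC. Qed.

Lemma mnm_sum_mul_neq0 n k (nu : 'I_k -> 'X_{1..n}) (mu : 'X_{1..k}) :
  (forall l, nu l != 0%MM) -> mu != 0%MM ->
  (\sum_(l < k) nu l *+ mu l)%MM != 0%MM.
Proof.
move=> nu0 /mnm_neq0_gt0 [l mul]; have [i nui] := mnm_neq0_gt0 (nu0 l).
apply/eqP => /mnmP /(_ i); rewrite mnm_sum_mulE mnm0E (bigD1 l) //=.
by move/eqP; rewrite addn_eq0 muln_eq0 !eqn0Ngt mul nui.
Qed.

(** The hypothesis on [nu] excludes cancellation: were [g_l] a constant, a
    monomial of [p] that differs from [mu] only in the exponent of [z_l] would
    have the same top term after substitution, and could cancel it. *)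
Lemma dominated_comp (R : realType) n k (p : {mpoly R[i][k]})
    (g : k.-tuple {mpoly R[i][n]}) mu (nu : 'I_k -> 'X_{1..n}) :
  dominated_by p mu -> (forall l, dominated_by (tnth g l) (nu l)) ->
  (forall l, nu l != 0%MM) ->
  dominated_by (p \mPo g) (\sum_(l < k) nu l *+ mu l)%MM.
Proof.
move=> /dominated_byE [mup pmu] gnu nu0; set M := (\sum_(l < k) _)%MM.
have degg l i : degz i (tnth g l) = nu l i.
  by have /dominated_byE [_ ->] := gnu l.
have le_mu m l : m \in msupp p -> (m l <= mu l)%N.
  by move=> mp; rewrite -pmu degz_geq.
suff Msupp : M \in msupp (p \mPo g).
  apply/dominated_byE; split=> // i; apply/eqP; rewrite eqn_leq degz_geq //.
  rewrite andbT; apply: leq_trans (degz_comp_le _ _ _) _.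
  apply/bigmax_leqP_seq => m mp _; rewrite mnm_sum_mulE.
  by apply: leq_sum => l _; rewrite degg leq_mul2r le_mu ?orbT.
rewrite mcoeff_msupp comp_mpolyE raddf_sum (bigD1_seq mu) ?msupp_uniq //= mcoeffZ.
rewrite [X in _ + X]big_seq_cond [X in _ + X]big1 => [|m /andP [mp m_mu]]; last first.
  rewrite mcoeffZ [X in _ * X]memN_msupp_eq0 ?mulr0 //; apply/negP.
  have [l lt_l] : exists l, (m l < mu l)%N.
    apply/existsP; apply: contra_neqT m_mu; rewrite negb_exists => /forallP H.
    by apply/mnmP => l; apply/eqP; rewrite eqn_leq le_mu // leqNgt H.
  have [i nui] := mnm_neq0_gt0 (nu0 l).
  move=> /degz_geq -/(_ i); apply/negP; rewrite -ltnNge.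
  apply: leq_ltn_trans (degz_prodX_le _ _ _) _; rewrite mnm_sum_mulE.
  rewrite (bigD1 l) //= [X in (_ < X)%N](bigD1 l) //= degg.
  rewrite -addSn leq_add ?ltn_pmul2r //.
  by apply: leq_sum => l' _; rewrite degg leq_mul2r le_mu ?orbT.
have g0 l : tnth g l != 0 by apply: dominated_neq0 (gnu l).
have -> : M = mlead (\prod_(l < k) tnth g l ^+ mu l).
  rewrite mlead_prod => [|l _ _]; last by rewrite expf_neq0.
  by apply: eq_bigr => l _; rewrite mleadX // (dominated_mlead (gnu l)).
rewrite addr0 mulf_neq0 // -?mcoeff_msupp //.
by rewrite mlead_supp //; apply/prodf_neq0 => l _; rewrite expf_neq0.
Qed.

(** A monomial whose weighted sum reaches that of the partial degrees reaches
    each partial degree, since the weights are positive; [degz_comp_le]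
    provides such a monomial. *)
Lemma dominated_of_degz_comp (R : realType) n k (p : {mpoly R[i][k]})
    (g : k.-tuple {mpoly R[i][n]}) (i : 'I_n) :
  p != 0 -> (forall l, (0 < degz i (tnth g l))%N) ->
  degz i (p \mPo g) = (\sum_(l < k) degz l p * degz i (tnth g l))%N ->
  has_dominant_term p.
Proof.
move=> p0 g_gt0 Hdeg; set d := fun l => degz i (tnth g l).
have [/hasP [m mp Hm]|] := boolP (has (fun m : 'X_{1..k} =>
    \sum_(l < k) degz l p * d l <= \sum_(l < k) m l * d l)%N (msupp p)).
  exists m; apply/dominated_byE; split=> // l; apply/eqP.
  rewrite eqn_leq [X in _ && X]degz_geq // andbT leqNgt.
  apply/negP => lt_l; move: Hm; apply/negP; rewrite -ltnNge.
  rewrite (bigD1 l) //= [X in (_ < X)%N](bigD1 l) //= -addSn.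
  rewrite leq_add ?ltn_pmul2r // ?g_gt0 //.
  by apply: leq_sum => l' _; rewrite leq_mul2r degz_geq ?orbT.
rewrite -all_predC => /allP lt_S.
have {}lt_S m : m \in msupp p ->
    (\sum_(l < k) m l * d l < degz i (p \mPo g))%N.
  by move=> /lt_S; rewrite /= -ltnNge Hdeg.
have S_gt0 := leq_ltn_trans (leq0n _) (lt_S _ (mlead_supp p0)).
have := degz_comp_le p g i; rewrite leqNgt -(prednK S_gt0) ltnS.
case/negP; apply/bigmax_leqP_seq => m mp _.
by rewrite -ltnS prednK //; apply: lt_S.
Qed.

(** * Degree matrices of iterates *)

Lemma mulmx_DegE (R : realType) n (f g : polymap R n) (i j : 'I_n) :
  (Deg g *m Deg f) i j =
  (\sum_(l < n) degz l (tnth f j) * degz i (tnth g l))%N%:Z.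
Proof.
rewrite mxE -[RHS]/(Posz _) (big_morph Posz PoszD (erefl _)).
by apply: eq_bigr => l _; rewrite !mxE mulrC.
Qed.

Lemma dominated_iter (R : realType) n (f : polymap R n) (mu : 'I_n -> 'X_{1..n}) :
  (forall j, dominated_by (tnth f j) (mu j)) -> (forall j, mu j != 0%MM) ->
  forall k, (exists nu : 'I_n -> 'X_{1..n}, forall j,
    dominated_by (tnth (iter_map f k) j) (nu j) /\ nu j != 0%MM) /\
    Deg (iter_map f k) = Deg f ^+ k.
Proof.
move=> fmu mu0; elim=> [|k [[nu Hnu] IH]].
  split; last first.
    by apply/matrixP => i j; rewrite !mxE tnth_mktuple degzXm mnm1E eq_sym;
      case: eqP.
  exists (fun j => U_(j)%MM) => j; rewrite tnth_mktuple.
  split; first exact: dominated_byXm.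
  by apply/eqP => /mnmP /(_ j); rewrite mnm1E eqxx mnm0E.
have dom j : dominated_by (tnth (iter_map f k.+1) j)
    (\sum_(l < n) nu l *+ mu j l)%MM.
  by rewrite tnth_mktuple; apply: dominated_comp => // l; case: (Hnu l).
split.
  exists (fun j => \sum_(l < n) nu l *+ mu j l)%MM => j; split=> //.
  by apply: mnm_sum_mul_neq0 => // l; case: (Hnu l).
rewrite exprSr -IH; apply/matrixP => i j; rewrite mulmx_DegE mxE.
have /dominated_byE [_ ->] := dom j.
rewrite mnm_sum_mulE; congr Posz; apply: eq_bigr => l _.
have /dominated_byE [_ ->] := fmu j.
by have [/dominated_byE [_ ->] _] := Hnu l.
Qed.

Theorem theorem7p5 (R : realType) (n : nat) (f : polymap R n) :
  (nonconstant_components f ->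
   (forall j : 'I_n, has_dominant_term (tnth f j)) ->
   algebraically_stable f)
  /\
  ((exists N : nat, (0 < N)%N /\
     forall i j : 'I_n, (0 < degz i (tnth (iter_map f N) j))%N) ->
   algebraically_stable f ->
   forall j : 'I_n, has_dominant_term (tnth f j)).
Proof.
split=> [f_nc f_dom k _|[N [N_gt0 degN]] stable j].
  have /fin_all_exists [mu fmu] := f_dom.
  suff mu0 j : mu j != 0%MM by have [] := dominated_iter fmu mu0 k.
  apply/eqP => muj0; have := fmu j; rewrite muj0 => /dominated0_const.
  exact: f_nc.
have fj0 : tnth f j != 0.
  apply/eqP => fj0; have := degN j j; case: N N_gt0 {degN} => // N _.
  by rewrite tnth_mktuple fj0 comp_mpoly0 degz0.
(* Any row of the degree matrices would do; row [j] is one that exists. *)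
apply: (dominated_of_degz_comp (g := iter_map f N) (i := j)) => //.
have := stable N.+1 isT; rewrite exprSr -stable //.
by move=> /matrixP /(_ j j); rewrite mulmx_DegE mxE tnth_mktuple => -[].
Qed.
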